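(* Let $\mathcal I\subseteq[0,1]$ be an interval of positive length $|\mathcal I|$ and let $\delta>0$. Then for $0<\epsilon\le1/2$, $$L_{\mathcal I}(\epsilon)=\frac{3}{\pi}+O_\delta\big(|\mathcal I|^{-1}\epsilon^{1/2-\delta}\big),$$ where the implied constant depends only on $\delta$.
   Context: For a reduced fraction $a/q$ ($q\ge1$, $\gcd(a,q)=1$) the Ford circle $C_{a/q}$ is the circle with center $a/q+\frac{i}{2q^2}$ and radius $\frac1{2q^2}$; let $D_{a/q}$ be the open disk it bounds. For an interval $\mathcal I\subseteq[0,1]$, $L_{\mathcal I}(\epsilon)$ is the probability that a uniformly random point of the segment $\{x+i\epsilon: x\in\mathcal I\}$ lies in one of the Ford disks $D_{a/q}$ with $a/q\in\mathcal I$; concretely $$L_{\mathcal I}(\epsilon)=\frac{1}{|\mathcal I|}\sum_{\substack{1\le a\le q,\ \gcd(a,q)=1\\ a/q\in\mathcal I,\ q^2\le1/\epsilon}}2\sqrt{r_q^2-(\epsilon-r_q)^2},\qquad r_q=\frac1{2q^2},$$ the sum of the lengths of the chords cut by the line $\operatorname{Im} z=\epsilon$ in these disks, divided by $|\mathcal I|$. *)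

(* Defs.v *)
From mathcomp Require Import all_boot all_order all_algebra.
From mathcomp Require Import all_classical all_reals all_analysis.
Set Implicit Arguments.
Unset Strict Implicit.
Unset Printing Implicit Defensive.
Import Order.TTheory GRing.Theory Num.Theory.
Import numFieldNormedType.Exports.
Local Open Scope classical_set_scope.
Local Open Scope ring_scope.

Definition itv_length (R : realType) (I : interval R) : R :=
  fine (lebesgue_measure [set` I]).

Definition ford_radius (R : realType) (q : nat) : R := 1 / (2 * q%:R ^+ 2).

(* Length of the chord cut by the line Im z = eps in the Ford circle of a
   reduced fraction of denominator q, whose center has height equal to its
   radius; meaningful when q ^ 2 <= 1 / eps. *)
Definition ford_chord (R : realType) (eps : R) (q : nat) : R :=
  2 * Num.sqrt (ford_radius R q ^+ 2 - (eps - ford_radius R q) ^+ 2).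

(* Since q <= q ^ 2, the range q <= truncn (1 / eps) contains every q >= 1 with
   q ^ 2 <= 1 / eps. *)
Definition ford_prob (R : realType) (I : interval R) (eps : R) : R :=
  (itv_length I)^-1 *
  \sum_(1 <= q < (Num.truncn (1 / eps)).+1 | (q%:R ^+ 2 <= 1 / eps :> R))
    \sum_(1 <= a < q.+1 | coprime a q && ((a%:R / q%:R : R) \in I))
      ford_chord eps q.

(* Main.v *)
(* Put s = sqrt eps and L = |I|.  The chord in a Ford disk of denominator q has
   length 2 s w(q) with w(q) = sqrt (1 - (q s)^2) / q, which vanishes for
   q >= 1 / s, so the theorem is about S = sum_q c(q) w(q), where c(q) counts the
   reduced a/q in I.  Since sum_(q | n) c(q) counts all b <= n with b/n in I, it is
   L n + O(1).  Hence V(n) = sum_q c(q) w(q n) satisfies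
     sum_k V(j k) = sum_n (L n + O(1)) w(n j) = L pi / (4 s j^2) + O(H / j),
   H a harmonic sum, by comparing sum_n sqrt (1 - (n j s)^2) with the area pi / 4
   of a quarter disk.  By zeta(2) = pi^2 / 6, subtracting A / n^2 from V(n) with
   A = 3 L / (2 pi s) removes the main term, and Moebius inversion applied to the
   difference gives V(1) = A + O(H^2), that is 2 s S / L = 3 / pi + O(s H^2 / L),
   where H is O(log (1 / eps)). *)
Require Import Defs.
From mathcomp Require Import all_boot all_order all_algebra.
From mathcomp Require Import all_classical all_reals all_analysis.
From mathcomp Require Import zify ring lra.
Set Implicit Arguments.
Unset Strict Implicit.
Unset Printing Implicit Defensive.
Import Order.TTheory GRing.Theory Num.Theory.
Import numFieldNormedType.Exports.
Local Open Scope classical_set_scope.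
Local Open Scope ring_scope.

(** * Sums over divisors and Moebius inversion *)

(** The substitution n = d k gives a sum over k <= N / d; the vanishing of [G] lets it run up to N,
    so that callers keep one range. *)
Lemma big_nat_multiples (V : nmodType) (N d : nat) (G : nat -> V) :
  (0 < d)%N -> (forall k, (N < d * k)%N -> G k = 0) ->
  \sum_(1 <= n < N.+1 | (d %| n)%N) G (n %/ d)%N = \sum_(1 <= k < N.+1) G k.
Proof.
move=> d0 GN.
transitivity (\sum_(1 <= n < N.+1) \sum_(1 <= k < N.+1 | (k == n %/ d)%N)
    (if (d %| n)%N then G k else 0)).
  rewrite big_mkcond; apply: eq_big_nat => n /andP[n0 nN].
  rewrite big_nat1_eq; case: ifP => // dn; last by rewrite if_same.
  case: ifP => // /negbT; case/dvdnP: dn n0 nN => m -> n0 nN.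
  by rewrite mulnK //; nia.
rewrite (exchange_big_dep_nat xpredT) //=; apply: eq_big_nat => k /andP[k0 kN].
transitivity (\sum_(1 <= n < N.+1 | (n == d * k)%N) G k).
  rewrite [RHS]big_mkcond [LHS]big_mkcond; apply: eq_big_nat => n _.
  have [->|nk] := eqVneq n (d * k)%N; first by rewrite mulKn // eqxx dvdn_mulr.
  case: eqVneq => // kE; case: ifP => // dn.
  by rewrite kE mulnC divnK ?eqxx in nk.
by rewrite big_nat1_eq; case: ifP => // /negbT h; rewrite GN //; nia.
Qed.

(** Pairs (j, k) are grouped by their product n = j k; products beyond N contribute nothing. *)
Lemma big_nat_divisors (V : nmodType) (N : nat) (F : nat -> nat -> V) :
  (forall j k, (N < j * k)%N -> F j k = 0) ->
  \sum_(1 <= j < N.+1) \sum_(1 <= k < N.+1) F j k =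
  \sum_(1 <= n < N.+1) \sum_(1 <= j < N.+1 | (j %| n)%N) F j (n %/ j)%N.
Proof.
move=> FN; rewrite [RHS](exchange_big_dep_nat xpredT) //=.
apply: eq_big_nat => j /andP[j0 _].
by rewrite (big_nat_multiples j0) // => k; exact: FN.
Qed.

Lemma big_divisors_widen (V : nmodType) (n N : nat) (F : nat -> V) :
  (0 < n <= N)%N ->
  \sum_(1 <= j < N.+1 | (j %| n)%N) F j = \sum_(1 <= j < n.+1 | (j %| n)%N) F j.
Proof.
case/andP=> n0 nN; rewrite (@big_cat_nat _ _ _ n.+1) //= [X in _ + X]big_nat_cond.
rewrite [X in _ + X]big1 ?addr0 // => j /andP[/andP[nj _] /(dvdn_leq n0)].
by rewrite leqNgt nj.
Qed.

(** Each b / n has exactly one reduced form a / q; then q divides n and b = a (n / q). *)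
Lemma big_gcd_partition (V : nmodType) (n : nat) (F : nat -> V) : (0 < n)%N ->
  \sum_(1 <= q < n.+1 | (q %| n)%N) \sum_(1 <= a < q.+1 | coprime a q)
     F (a * (n %/ q))%N = \sum_(1 <= b < n.+1) F b.
Proof.
move=> n0.
transitivity (\sum_(1 <= q < n.+1) \sum_(1 <= a < n.+1) \sum_(1 <= b < n.+1)
   if [&& q %| n, a <= q, coprime a q & b == a * (n %/ q)]%N then F b else 0).
  rewrite big_mkcond; apply: eq_big_nat => q /andP[q0 qn].
  case: ifP => qdvd; last by rewrite big1 // => a _; rewrite big1.
  rewrite [RHS](@big_cat_nat _ _ _ q.+1) //= [X in _ + X]big_nat_cond.
  rewrite [X in _ + X]big1 ?addr0; last first.
    move=> a /andP[/andP[qa _] _]; rewrite big1 // => b _.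
    by rewrite leqNgt qa.
  rewrite big_mkcond; apply: eq_big_nat => a /andP[a0 aq].
  case: ifP => cop; last by rewrite big1 // => b _; rewrite andbF.
  rewrite -ltnS aq /= -big_mkcond big_nat1_eq; case: ifP => // /negbT.
  by case/dvdnP: qdvd n0 qn => m -> n0 qn; rewrite mulnK //; nia.
under eq_bigr do rewrite exchange_big.
rewrite exchange_big; apply: eq_big_nat => b /andP[b0 bn] /=.
(* For fixed b, the only admissible pair is q = n / g, a = b / g. *)
set g := gcdn b n; have g0 : (0 < g)%N by rewrite gcdn_gt0 b0.
have [gb gn] : (g %| b)%N /\ (g %| n)%N by rewrite dvdn_gcdl dvdn_gcdr.
transitivity (\sum_(1 <= q < n.+1 | (q == n %/ g)%N)
   \sum_(1 <= a < n.+1 | (a == b %/ g)%N) F b).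
  rewrite [RHS]big_mkcond; apply: eq_big_nat => q /andP[q0 qn].
  transitivity (\sum_(1 <= a < n.+1)
     if (q == n %/ g)%N && (a == b %/ g)%N then F b else 0); last first.
    case: ifP => h; last by rewrite big1.
    by rewrite [RHS]big_mkcond.
  apply: eq_big_nat => a /andP[a0 an]; congr (if _ then _ else _).
  apply/idP/idP.
    case/and4P => /dvdnP[m nE] aq cop /eqP.
    rewrite nE mulnK // => bE.
    have m0 : (0 < m)%N by move: n0; rewrite nE muln_gt0 => /andP[].
    have gE : g = m by rewrite /g bE nE mulnC -muln_gcdr (eqP cop) muln1.
    by rewrite gE bE mulKn // mulnK // !eqxx.
  case/andP => /eqP -> /eqP ->.
  rewrite dvdn_div // leq_div2r //=.
  rewrite divnA // mulKn // ?divnK ?eqxx ?andbT //.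
  rewrite /coprime -(eqn_pmul2r g0) mul1n muln_gcdl !divnK //.
have ng : (0 < n %/ g < n.+1)%N by rewrite divn_gt0 // dvdn_leq //= ltnS leq_div.
have bg : (0 < b %/ g < n.+1)%N.
  rewrite divn_gt0 // dvdn_leq //= ltnS (leq_trans (leq_div _ _)) //.
by rewrite big_nat1_eq ng big_nat1_eq bg.
Qed.

Definition mobius (R : pzRingType) (n : nat) : R :=
  \prod_(p <- primes n) (if logn p n == 1%N then -1 else 0).

Lemma norm_mobius_le1 (R : numDomainType) (n : nat) : `|mobius R n| <= 1.
Proof.
rewrite /mobius; elim/big_ind: _ => [|x y x1 y1|p _]; first by rewrite normr1.
  by rewrite normrM mulr_ile1.
by case: ifP => _; rewrite ?normrN1 ?normr0.
Qed.

Lemma mobius_mul_prime (R : comPzRingType) (p k : nat) : prime p -> (0 < k)%N ->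
  mobius R (p * k) = if (p %| k)%N then 0 else - mobius R k.
Proof.
move=> pp k0; have p0 := prime_gt0 pp.
case: ifP => pk.
  rewrite /mobius (bigD1_seq p) ?primes_uniq //=; last first.
    by rewrite mem_primes pp muln_gt0 p0 k0 dvdn_mulr.
  rewrite lognM // logn_prime // eqxx.
  suff : (0 < logn p k)%N by case: (logn p k) => // m _; rewrite mul0r.
  by rewrite logn_gt0 mem_primes pp k0.
have perm : perm_eq (primes (p * k)) (p :: primes k).
  apply: uniq_perm; rewrite ?primes_uniq //= ?primes_uniq ?andbT.
    by rewrite mem_primes pk !andbF.
  move=> r; rewrite primesM // in_cons; congr (_ || _).
  by rewrite primes_prime // inE.
rewrite /mobius (perm_big _ perm) big_cons lognM // logn_prime // eqxx.
rewrite (logn_coprime (m := k)) ?prime_coprime ?pk //= mulN1r; congr (- _).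
rewrite !big_seq; apply: eq_bigr => r; rewrite mem_primes => /and3P[pr _ rk].
have rp : r != p by apply: contraFneq pk => <-.
by rewrite lognM // logn_prime // (negPf rp).
Qed.

(** For a prime p dividing n, the divisors p k with k prime to p cancel the divisors k, and those
    with p | k have value 0. *)
Lemma sum_mobius_divisors (R : comPzRingType) (n : nat) : (0 < n)%N ->
  \sum_(1 <= d < n.+1 | (d %| n)%N) mobius R d = (n == 1%N)%:R.
Proof.
move=> n0; have [->|n1] := eqVneq n 1%N.
  by rewrite big_mkcond big_nat1 /= /mobius big_nil.
have pp : prime (pdiv n) by apply: pdiv_prime; lia.
have pn := pdiv_dvd n; move: (pdiv n) pp pn => p pp pn.
have p0 := prime_gt0 pp.
rewrite (bigID (dvdn p)) /=.
rewrite (eq_bigl (fun d => (p %| d) && (d %| n))%N); last by move=> d; rewrite andbC.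
rewrite big_mkcondr /=.
rewrite (eq_bigr (fun d => if (p * (d %/ p) %| n)%N
    then mobius R (p * (d %/ p)) else 0));
  last by move=> d pd; rewrite mulnC divnK.
rewrite (big_nat_multiples (G := fun k => if (p * k %| n)%N
    then mobius R (p * k) else 0)) //;
  last first.
  by move=> k nk; case: ifP => // /(dvdn_leq n0); rewrite leqNgt nk.
rewrite [X in _ + X]big_mkcond -big_split big_nat big1 //= => k /andP[k0 kn].
rewrite mobius_mul_prime //; case: (boolP (p %| k)%N) => pk /=.
  by rewrite andbF if_same addr0.
rewrite andbT Gauss_dvd ?prime_coprime // pn /=.
by case: ifP; rewrite ?addNr ?addr0.
Qed.

(** After grouping by n = j k, the coefficient of [u n] is the sum of [mobius] over the divisors of
    n, which is 1 at n = 1 and 0 elsewhere. *)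
Lemma mobius_inversion_at1 (R : comPzRingType) (N : nat) (u : nat -> R) :
  (0 < N)%N -> (forall n, (N < n)%N -> u n = 0) ->
  u 1%N = \sum_(1 <= j < N.+1) mobius R j * \sum_(1 <= k < N.+1) u (j * k)%N.
Proof.
move=> N0 uN; under eq_bigr do rewrite mulr_sumr.
rewrite (big_nat_divisors (F := fun j k => mobius R j * u (j * k)%N)); last first.
  by move=> j k jk; rewrite uN ?mulr0.
transitivity (\sum_(1 <= n < N.+1) (n == 1%N)%:R * u n).
  by rewrite big_nat_recl // mul1r big_nat big1 ?addr0 // => -[|k] // _; rewrite mul0r.
apply: eq_big_nat => n /andP[n0 nN]; rewrite -(sum_mobius_divisors R n0).
rewrite big_distrl /= -(@big_divisors_widen _ _ N) ?n0 //.
by apply: eq_bigr => j jn; rewrite mulnC divnK.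
Qed.

(** * The area of the quarter disk *)

Lemma ge0_derive_le (R : realType) (f df : R -> R) (a b : R) : a <= b ->
  (forall x : R, is_derive x 1 f (df x)) ->
  (forall x, a <= x <= b -> 0 <= df x) -> f a <= f b.
Proof.
move=> ab fdf df0.
have [|c] := @MVT_segment R f df a b ab (fun x _ => fdf x).
  apply: derivable_within_continuous => x _.
  by have := fdf x; case.
rewrite in_itv /= => cab fba; rewrite -subr_ge0 fba.
by rewrite mulr_ge0 ?df0 ?subr_ge0.
Qed.

Lemma sin_le_id (R : realType) (x : R) : 0 <= x -> sin x <= x.
Proof.
move=> x0; rewrite -subr_ge0.
have := @ge0_derive_le R (fun y => y - sin y) (fun y => 1 - cos y) _ _ x0.
rewrite sin0 subrr; apply=> y _.
by rewrite subr_ge0 cos_le1.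
Qed.

Lemma mulr_cos_le_sin (R : realType) (x : R) : 0 <= x <= pi -> x * cos x <= sin x.
Proof.
case/andP=> x0 xpi; rewrite -subr_ge0.
have := @ge0_derive_le R (fun y => sin y - y * cos y) (fun y => y * sin y) _ _ x0.
rewrite sin0 mul0r subrr; apply => [y|y /andP[y0 yx]]; last first.
  by rewrite mulr_ge0 // sin_ge0_pi // y0 (le_trans yx).
apply: is_derive_eq.
by rewrite /GRing.scale /=; ring.
Qed.

(** The upper bound is the square of x cos x <= sin x, with cos^2 = 1 - sin^2, divided by x^2
    sin^2. *)
Lemma invr_sqr_sin_bounds (R : realType) (x : R) : 0 < x -> x <= pi / 2 ->
  x ^- 2 <= sin x ^- 2 <= 1 + x ^- 2.
Proof.
move=> x0 xpi; have pi0 := pi_gt0 R.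
have s0 : 0 < sin x by apply: sin_gt0_pi; apply/andP; split => //; lra.
have c0 : 0 <= cos x by apply: cos_ge0_pihalf; apply/andP; split => //; lra.
have sx := sin_le_id (ltW x0).
have xc : x * cos x <= sin x by apply: mulr_cos_le_sin; apply/andP; split; lra.
apply/andP; split.
  rewrite lef_pV2 ?posrE ?exprn_gt0 // ler_sqr ?nnegrE ?(ltW s0) ?(ltW x0) //.
rewrite -(ler_pM2r (exprn_gt0 2 s0)) mulVf ?gt_eqF ?exprn_gt0 //.
rewrite -(ler_pM2l (exprn_gt0 2 x0)) mulr1 mulrA mulrDr mulfV ?gt_eqF ?exprn_gt0 //.
have : (x * cos x) ^+ 2 <= sin x ^+ 2.
  by rewrite ler_sqr ?nnegrE ?mulr_ge0 // ltW.
by rewrite exprMn cos2sin2; lra.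
Qed.

(* Area of the part of the unit quarter disk lying over [0, sin t]. *)
Definition circle_area (R : realType) (t : R) : R := (sin t * cos t + t) / 2.

Lemma is_derive_circle_area (R : realType) (t : R) :
  is_derive t 1 (@circle_area R) (cos t ^+ 2).
Proof.
have -> : @circle_area R = fun y => 2^-1 * (sin y * cos y + y).
  by apply/funext => y; rewrite /circle_area mulrC.
apply: is_derive_eq.
rewrite /GRing.scale /= ?mulr0 ?addr0; have := cos2Dsin2 t.
by move=> h; rewrite -[X in _ + X]h; field.
Qed.

(** The strip of the quarter disk over [sin a, sin b] lies between rectangles of heights cos b and
    cos a. Formally, the differences have derivatives cos y (cos y - cos b) and cos y (cos a - cos
    y), nonnegative on [a, b]. *)
Lemma circle_area_bounds (R : realType) (a b : R) : 0 <= a -> a <= b -> b <= pi / 2 ->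
  cos b * (sin b - sin a) <= circle_area b - circle_area a <=
  cos a * (sin b - sin a).
Proof.
move=> a0 ab bpi; have pi0 := pi_gt0 R.
have cos_anti u v : a <= u -> u <= v -> v <= b -> cos v <= cos u.
  move=> au; rewrite le_eqVlt => /predU1P[-> //|uv vb]; apply: ltW.
  by rewrite ltr_cos // in_itv /=; apply/andP; split; lra.
have cos_pos u : a <= u -> u <= b -> 0 <= cos u.
  by move=> au ub; apply: cos_ge0_pihalf; apply/andP; split; lra.
have dcos (k x : R) : is_derive x 1 (fun y => k * sin y) (k * cos x).
  by apply: is_derive_eq; rewrite /GRing.scale /= ?mulr0 ?addr0.
apply/andP; split.
- have := @ge0_derive_le R (fun y => circle_area y - cos b * sin y)
    (fun y => cos y ^+ 2 - cos b * cos y) a b ab.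
  suff h : forall y, a <= y <= b -> 0 <= cos y ^+ 2 - cos b * cos y.
    move=> /(_ _ h) h2.
    suff: circle_area a - cos b * sin a <= circle_area b - cos b * sin b by lra.
    by apply: h2 => y; apply: is_deriveB; exact: is_derive_circle_area.
  move=> y /andP[ay yb]; rewrite expr2 -mulrBl mulr_ge0 ?cos_pos // subr_ge0.
  exact: cos_anti.
- have := @ge0_derive_le R (fun y => cos a * sin y - circle_area y)
    (fun y => cos a * cos y - cos y ^+ 2) a b ab.
  suff h : forall y, a <= y <= b -> 0 <= cos a * cos y - cos y ^+ 2.
    move=> /(_ _ h) h2.
    suff: cos a * sin a - circle_area a <= cos a * sin b - circle_area b by lra.
    by apply: h2 => y; apply: is_deriveB; exact: is_derive_circle_area.
  move=> y /andP[ay yb]; rewrite expr2 -mulrBl mulr_ge0 ?cos_pos // subr_ge0.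
  exact: cos_anti.
Qed.

(** Since [g] decreases, Y times the area over [n / Y, (n + 1) / Y] lies between its values at the
    two ends, and these areas telescope. The condition on N makes the grid up to N + 1 cover
    [0, 1]. *)
Lemma sum_sqrt_riemann (R : realType) (Y : R) (N : nat) : 0 < Y -> Y <= N.+1%:R ->
  Y * (pi / 4) - 1 <= \sum_(1 <= n < N.+1) Num.sqrt (1 - (n%:R / Y) ^+ 2) <=
  Y * (pi / 4).
Proof.
move=> Y0 YN; pose g (t : R) := Num.sqrt (1 - t ^+ 2).
(* Area of the quarter disk over [0, min t 1], hence constant from t = 1 on. *)
pose F (t : R) := circle_area (asin (Order.min t 1)).
have F0 : F 0 = 0.
  by rewrite /F min_l // -sin0 sinK ?/circle_area ?sin0 ?mul0r ?addr0 ?mul0r //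
    in_itv /=; have := pi_gt0 R => pi0; apply/andP; split; lra.
have F1 t : 1 <= t -> F t = pi / 4.
  move=> t1; rewrite /F min_r //.
  have -> : asin 1 = pi / 2 :> R.
    rewrite -[in LHS]sin_pihalf sinK // in_itv /=.
    by have := pi_gt0 R => pi0; apply/andP; split; lra.
  by rewrite /circle_area cos_pihalf mulr0 add0r; field.
have asin_ok t : 0 <= t -> t <= 1 ->
    [/\ 0 <= asin t, asin t <= pi / 2, sin (asin t) = t & cos (asin t) = g t].
  move=> t0 t1; have t11 : -1 <= t <= 1 by apply/andP; split; lra.
  split; [|exact: asin_lepi2| |exact: cos_asin].
    have [//|neg] := leP 0 (asin t).
    have : sin (asin t) < sin 0.
      have pi0 := pi_gt0 R; have := asin_geNpi2 t11 => h.
      by rewrite ltr_sin // in_itv /=; apply/andP; split; lra.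
    by rewrite asinK ?in_itv //= sin0 ltNge t0.
  by rewrite asinK // in_itv.
have Fin s t : 0 <= s -> s <= t -> t <= 1 ->
    g t * (t - s) <= F t - F s <= g s * (t - s).
  move=> s0 st t1.
  have [as0 aspi sas cas] := asin_ok s s0 (le_trans st t1).
  have [at0 atpi sat cat] := asin_ok t (le_trans s0 st) t1.
  rewrite /F !min_l // ?(le_trans st) //.
  have ast : asin s <= asin t.
    have [//|neg] := leP (asin s) (asin t).
    have : sin (asin t) < sin (asin s).
      have pi0 := pi_gt0 R.
      by rewrite ltr_sin // in_itv /=; apply/andP; split; lra.
    by rewrite sat sas ltNge st.
  by have := circle_area_bounds as0 ast atpi; rewrite sat sas cas cat.
have g1 t : 1 <= t -> g t = 0.
  by move=> t1; apply: ler0_sqrtr; rewrite subr_le0 exprn_ege1.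
have gge0 t : 0 <= g t by exact: sqrtr_ge0.
have Fst s t : 0 <= s -> s <= t -> g t * (t - s) <= F t - F s <= g s * (t - s).
  move=> s0 st; have [t1|t1] := leP t 1; first exact: Fin.
  have [s1|s1] := leP s 1; last first.
    by rewrite !F1 ?(ltW s1) ?(ltW t1) // !g1 ?(ltW s1) ?(ltW t1) // !mul0r subrr lexx.
  have /andP[h1 h2] := Fin s 1 s0 s1 (lexx _).
  rewrite (g1 t (ltW t1)) mul0r (F1 t (ltW t1)) -(F1 1 (lexx 1)).
  rewrite (g1 1 (lexx 1)) mul0r in h1; rewrite h1 /= (le_trans h2) //.
  by rewrite ler_wpM2l // lerD2r ltW.
have step (n : nat) :
    g (n.+1%:R / Y) <= Y * (F (n.+1%:R / Y) - F (n%:R / Y)) <= g (n%:R / Y).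
  have iY : 0 < Y^-1 by rewrite invr_gt0.
  have nY : n%:R / Y <= n.+1%:R / Y by rewrite ler_wpM2r ?ltW // ltr_nat.
  have /andP[] := Fst _ _ (divr_ge0 (ler0n R n) (ltW Y0)) nY.
  rewrite -mulrBl -natrB // subSnn mul1r !ler_pdivrMr // !ler_pdivlMr //.
  by rewrite [Y * _]mulrC => -> ->.
apply/andP; split.
(* The 1 moved to the right is the term n = 0, as [g 0] = 1. *)
- rewrite lerBlDr; apply: (@le_trans _ _ (\sum_(0 <= n < N.+1) g (n%:R / Y))).
    apply: (@le_trans _ _ (\sum_(0 <= n < N.+1) Y * (F (n.+1%:R / Y) - F (n%:R / Y)))).
      rewrite -mulr_sumr telescope_sumr // mul0r F0 subr0 F1 //.
      by rewrite ler_pdivlMr // mul1r.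
    by apply: ler_sum => n _; have /andP[] := step n.
  rewrite big_nat_recl // big_add1 /= mul0r addrC lerD2l /g expr0n /= subr0.
  by rewrite sqrtr1.
- rewrite big_add1 /=.
  apply: (@le_trans _ _ (\sum_(0 <= n < N) Y * (F (n.+1%:R / Y) - F (n%:R / Y)))).
    by apply: ler_sum => n _; have /andP[] := step n.
  rewrite -mulr_sumr telescope_sumr // mul0r F0 subr0.
  apply: ler_wpM2l; first exact: ltW.
  (* Here the grid ends at N / Y, which may fall short of 1; monotonicity of [F] suffices. *)
  set t := N%:R / Y; have [t1|t1] := leP 1 t; first by rewrite F1.
  have t0 : 0 <= t by rewrite divr_ge0 // ltW.
  have /andP[h _] := Fst t 1 t0 (ltW t1); rewrite -subr_ge0 -(F1 1) //.
  by apply: le_trans h; rewrite g1 // mul0r.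
Qed.

(** * The value of zeta(2) *)

(* Halving each angle y and pairing it with pi / 2 - y, by
   sin (2 y) ^- 2 = (sin y ^- 2 + cos y ^- 2) / 4. *)
Lemma sum_invr_sqr_sin_double (R : realType) (K : nat) : (0 < K)%N ->
  \sum_(0 <= k < 2 * K) sin ((2 * k + 1)%:R * pi / (4 * (2 * K))%:R) ^- 2 =
  4 * \sum_(0 <= k < K) sin ((2 * k + 1)%:R * pi / (4 * K)%:R) ^- 2 :> R.
Proof.
move=> K0; have pi0 := pi_gt0 R.
rewrite (@big_cat_nat _ _ _ K) //=; last by lia.
rewrite [X in _ + X]big_nat_rev /=.
rewrite -{3}[K]add0n big_addn; have -> : (2 * K - K = K)%N by lia.
rewrite -big_split /= mulr_sumr; apply: eq_big_nat => k /andP[_ kK].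
have KR : 0 < K%:R :> R by rewrite ltr0n.
have kR : k%:R + 1 <= K%:R :> R by rewrite natr1 ler_nat.
have k0 : 0 <= k%:R :> R by [].
set y : R := (2 * k + 1)%:R * pi / (4 * (2 * K))%:R.
have yE : y = (2 * k%:R + 1) * pi / (8 * K%:R).
  by rewrite /y natrD !natrM; field; rewrite gt_eqF.
have -> : (2 * (K + 2 * K - (k + K).+1) + 1)%:R * pi / (4 * (2 * K))%:R = pi / 2 - y.
  have -> : (2 * (K + 2 * K - (k + K).+1) + 1 = 4 * K - (2 * k + 1))%N by lia.
  rewrite yE natrB; last by lia.
  by rewrite natrD !natrM; field; rewrite gt_eqF.
have -> : (2 * k + 1)%:R * pi / (4 * K)%:R = y *+ 2.
  by rewrite yE natrD !natrM; field; rewrite gt_eqF.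
have y0 : 0 < y by rewrite yE; apply: divr_gt0; [apply: mulr_gt0|]; lra.
have ypi : y < pi / 2.
  by rewrite yE ltr_pdivrMr; [nra|lra].
have s0 : sin y != 0 by rewrite gt_eqF // sin_gt0_pihalf // y0.
have c0 : cos y != 0 by rewrite gt_eqF // cos_gt0_pihalf //; apply/andP; split; lra.
rewrite sinB sin_pihalf cos_pihalf mul1r mul0r subr0 sin_mulr2n.
have := cos2Dsin2 y => h.
transitivity ((cos y ^+ 2 + sin y ^+ 2) / (cos y * sin y) ^+ 2).
  by field; rewrite s0.
by rewrite h; field; rewrite s0.
Qed.

(** Each doubling multiplies the sum by 4, starting from the single term sin (pi / 4) ^- 2 = 2. *)
Lemma sum_invr_sqr_sin_pow2 (R : realType) (n : nat) :
  \sum_(0 <= k < 2 ^ n) sin ((2 * k + 1)%:R * pi / (4 * 2 ^ n)%:R) ^- 2 =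
  2 * (2 ^ n)%:R ^+ 2 :> R.
Proof.
elim: n => [|n IH]; last first.
  rewrite expnS sum_invr_sqr_sin_double ?expn_gt0 // IH natrM.
  by ring.
rewrite big_nat1 /= expr1n mulr1 mul1r expn0 muln1.
(* The addition formula gives 2 s c = 1 = s^2 + c^2 for the sine s and cosine c of pi / 4, so s = c
   and s^2 = 1 / 2. *)
have : sin (pi / 4 + pi / 4 : R) = 1.
  by have -> : pi / 4 + pi / 4 = pi / 2 :> R; [field|exact: sin_pihalf].
rewrite sinD; have := cos2Dsin2 (pi / 4 : R).
set s := sin _; set c := cos _ => h1 h2.
have h3 : (s - c) ^+ 2 = 0 by lra.
have sc : s = c by apply/eqP; rewrite -subr_eq0 -sqrf_eq0 h3.
have s2 : s ^+ 2 = 2^-1 by rewrite -sc in h1; lra.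
by rewrite s2 invrK.
Qed.

(** In the exact sum of K = 2^n terms, replacing sin x ^- 2 by x ^- 2 costs at most 1 per term.
    Rescaling by pi^2 / (16 K^2) turns the total cost K into pi^2 / (16 K). *)
Lemma sum_invr_sqr_odd_bounds (R : realType) (n : nat) :
  @pi R ^+ 2 / 8 - @pi R ^+ 2 / (16 * (2 ^ n)%:R) <=
  \sum_(0 <= k < 2 ^ n) (2 * k + 1)%:R ^- 2 <= @pi R ^+ 2 / 8.
Proof.
have pi0 := pi_gt0 R; have := sum_invr_sqr_sin_pow2 R n.
set K := (2 ^ n)%N; have K0 : (0 < K)%N by rewrite expn_gt0.
have KR : 0 < K%:R :> R by rewrite ltr0n.
set O := \sum_(0 <= k < _) _ ^- 2; move=> SE.
pose x (k : nat) : R := (2 * k + 1)%:R * pi / (4 * K)%:R.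
have xb k : (k < K)%N -> x k ^- 2 <= sin (x k) ^- 2 <= 1 + x k ^- 2.
  move=> kK; apply: invr_sqr_sin_bounds.
    by rewrite /x divr_gt0 ?mulr_gt0 ?ltr0n //; lia.
  rewrite /x ler_pdivrMr ?ltr0n; last by lia.
  have -> : pi / 2 * (4 * K)%:R = (2 * K)%:R * pi :> R.
    by rewrite !natrM; field.
  by apply: ler_wpM2r; [exact: ltW|rewrite ler_nat; lia].
have xO : \sum_(0 <= k < K) x k ^- 2 = 16 * K%:R ^+ 2 / pi ^+ 2 * O.
  rewrite /O mulr_sumr; apply: eq_big_nat => k _; rewrite /x natrM.
  have : (2 * k + 1)%:R != 0 :> R by rewrite pnatr_eq0 addn1.
  move: ((2 * k + 1)%:R : R) (@pi R) pi0 => z p p0 z0; field.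
  by rewrite z0 (gt_eqF p0) (gt_eqF KR).
have lo : 16 * K%:R ^+ 2 / pi ^+ 2 * O <= 2 * K%:R ^+ 2.
  rewrite -xO -SE !big_nat; apply: ler_sum => k /andP[_ kK].
  by have /andP[] := xb k kK.
have hi : 2 * K%:R ^+ 2 <= K%:R + 16 * K%:R ^+ 2 / pi ^+ 2 * O.
  have KE : K%:R = \sum_(0 <= k < K) 1 :> R by rewrite sumr_const_nat subn0.
  rewrite -xO -SE [X in X + _]KE -big_split.
  rewrite !big_nat; apply: ler_sum => k /andP[_ kK].
  by have /andP[] := xb k kK.
have pi2 : 0 < pi ^+ 2 :> R by exact: exprn_gt0.
have a0 : 0 < pi ^+ 2 / (16 * K%:R ^+ 2) :> R.
  by rewrite divr_gt0 // mulr_gt0 // exprn_gt0.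
rewrite -(ler_pM2l a0) in lo; rewrite -(ler_pM2l a0) in hi.
have E1 : pi ^+ 2 / (16 * K%:R ^+ 2) * (16 * K%:R ^+ 2 / pi ^+ 2 * O) = O.
  by move: (@pi R) pi0 => p p0; field; rewrite ?(gt_eqF p0) (gt_eqF KR).
have E2 : pi ^+ 2 / (16 * K%:R ^+ 2) * (2 * K%:R ^+ 2) = pi ^+ 2 / 8 :> R.
  by move: (@pi R) pi0 => p p0; field; rewrite ?(gt_eqF p0) (gt_eqF KR).
have E3 : pi ^+ 2 / (16 * K%:R ^+ 2) * K%:R = pi ^+ 2 / (16 * K%:R) :> R.
  by move: (@pi R) pi0 => p p0; field; rewrite ?(gt_eqF p0) (gt_eqF KR).
rewrite mulrDr E1 E2 E3 in hi; rewrite E1 E2 in lo.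
by rewrite lo andbT; lra.
Qed.

Definition zeta2_sum (R : realType) (M : nat) : R := \sum_(1 <= k < M.+1) k%:R ^- 2.

Lemma zeta2_sum_double (R : realType) (M : nat) :
  zeta2_sum R (2 * M) =
  \sum_(0 <= k < M) (2 * k + 1)%:R ^- 2 + zeta2_sum R M / 4.
Proof.
rewrite /zeta2_sum; elim: M => [|M IH]; first by rewrite !big_nil mul0r addr0.
have -> : (2 * M.+1 = (2 * M).+2)%N by lia.
rewrite [LHS]big_nat_recr // [X in X + _ = _]big_nat_recr //= IH.
rewrite [X in X + _ = _]addrAC [in RHS]big_nat_recr //=.
rewrite [X in _ = _ + X / _]big_nat_recr //=.
have -> : (2 * M).+2%:R = 2 * M.+1%:R :> R by rewrite -natrM; congr _%:R; lia.
rewrite addn1 -/(zeta2_sum R M); have : M.+1%:R != 0 :> R by rewrite pnatr_eq0.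
move: (M.+1%:R : R) ((2 * M).+1%:R ^- 2 : R) (\sum_(0 <= k < M) _) => m a b m0.
by field.
Qed.

(** Passing from K to 2 K quarters the old error 4 / K and adds at most pi^2 / (16 K) <= 1 / K from
    the odd terms, in all 2 / K = 4 / (2 K). The limit is consistent: pi^2 / 8 + pi^2 / 24 = pi^2 /
    6. *)
Lemma zeta2_sum_pow2 (R : realType) (n : nat) :
  `|zeta2_sum R (2 ^ n) - pi ^+ 2 / 6| <= 4 / (2 ^ n)%:R.
Proof.
have pi0 := pi_gt0 R; have pi4 : pi < 4 :> R by have := pihalf_lt2 R; lra.
have pi16 : pi ^+ 2 <= 16 :> R by nra.
elim: n => [|n IH].
  rewrite expn0 /zeta2_sum big_nat1 expr1n invr1 ler_norml.
  by apply/andP; split; nra.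
rewrite expnS zeta2_sum_double; move: IH.
have := sum_invr_sqr_odd_bounds R n.
have : 0 < (2 ^ n)%:R :> R by rewrite ltr0n expn_gt0.
rewrite natrM; move: ((2 ^ n)%:R : R) (\sum_(0 <= k < 2 ^ n) _) (zeta2_sum R (2 ^ n)).
move=> K O z K0 /andP[lo1 hi1].
have -> : 4 / (2 * K) = 2 / K by field; rewrite gt_eqF.
have h : pi ^+ 2 / (16 * K) <= K^-1.
  rewrite ler_pdivrMr ?mulr_gt0 //.
  by have -> : K^-1 * (16 * K) = 16 by field; rewrite gt_eqF.
have : 0 < K^-1 by rewrite invr_gt0.
move: h lo1 hi1; set i := K^-1; set p := _ / (16 * K); set P := pi ^+ 2.
move=> h lo1 hi1 i0; rewrite !ler_norml => /andP[h1 h2].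
by apply/andP; split; lra.
Qed.

(** Telescoping of 1 / (k + 1)^2 <= 1 / k - 1 / (k + 1). *)
Lemma zeta2_sum_diff (R : realType) (M n : nat) : (0 < M)%N ->
  0 <= zeta2_sum R (M + n) - zeta2_sum R M <= M%:R^-1 - (M + n)%:R^-1.
Proof.
move=> M0; elim: n => [|n /andP[IH1 IH2]]; first by rewrite addn0 !subrr lexx.
rewrite addnS /zeta2_sum big_nat_recr //= -!/(zeta2_sum _ _).
have k0 : 0 < (M + n)%:R :> R by rewrite ltr0n; lia.
rewrite -natr1; move: k0 IH1 IH2.
move: ((M + n)%:R : R) (zeta2_sum R (M + n)) (zeta2_sum R M) => k a b k0 IH1 IH2.
have h0 : 0 <= (k + 1) ^- 2 by rewrite invr_ge0 exprn_ge0 //; lra.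
suff : (k + 1) ^- 2 <= k^-1 - (k + 1)^-1 by move=> h; apply/andP; split; lra.
have -> : k^-1 - (k + 1)^-1 = (k * (k + 1))^-1.
  by field; apply/andP; split; rewrite gt_eqF //; lra.
by rewrite lef_pV2 ?posrE ?exprn_gt0 ?mulr_gt0 //; nra.
Qed.

(** Comparison with the partial sum at 2^M >= M: the terms in between cost at most 1 / M, the error
    there at most 4 / M. *)
Lemma zeta2_sum_estimate (R : realType) (M : nat) : (0 < M)%N ->
  `|zeta2_sum R M - pi ^+ 2 / 6| <= 5 / M%:R.
Proof.
move=> M0; have MM : (M <= 2 ^ M)%N by apply: ltnW; apply: ltn_expl.
have := zeta2_sum_diff R (2 ^ M - M) M0; rewrite subnKC //.
have := zeta2_sum_pow2 R M.
have MR : 0 < M%:R :> R by rewrite ltr0n.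
have h : (2 ^ M)%:R^-1 <= M%:R^-1 :> R.
  by rewrite lef_pV2 ?posrE ?ltr0n ?expn_gt0 // ler_nat.
have h0 : 0 <= (2 ^ M)%:R^-1 :> R by rewrite invr_ge0.
rewrite !ler_norml => /andP[h1 h2] /andP[h3 h4].
by apply/andP; split; lra.
Qed.

(** * Counting fractions and harmonic sums *)

(** With m the integer part of y, [P] holds below m and fails above m, so the count is m - 1 or m.
    Leaving [P] free at b = y covers open and closed ends alike. *)
Lemma count_initial_segment (R : realType) (n : nat) (P : pred nat) (y : R) :
  0 <= y <= n%:R -> (forall b, b%:R < y -> P b) -> (forall b, P b -> b%:R <= y) ->
  `|\sum_(1 <= b < n.+1 | P b) 1 - y| <= 2.
Proof.
case/andP=> y0 yn Plo Phi; set m := Num.truncn y.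
have /andP[my ym] : m%:R <= y < m.+1%:R by apply: truncn_itv.
have mn : (m <= n)%N by rewrite -(ler_nat R) (le_trans my).
have hi : \sum_(1 <= b < n.+1 | P b) 1 <= m%:R :> R.
  have -> : m%:R = \sum_(1 <= b < m.+1) 1 :> R by rewrite sumr_const_nat subn1.
  rewrite (@big_nat_widen _ _ _ _ m.+1 n.+1) // big_mkcond [leRHS]big_mkcond.
  apply: ler_sum => b _; case: ifP => [/Phi by_|_]; last by case: ifP.
  by rewrite -(ltr_nat R) (le_lt_trans by_ ym).
have lo : m%:R - 1 <= \sum_(1 <= b < n.+1 | P b) 1 :> R.
  case: m my ym mn {hi} => [|m] my ym mn.
    by apply: le_trans (_ : 0 <= _); [lra|apply: sumr_ge0].
  have -> : m.+1%:R - 1 = \sum_(1 <= b < m.+1) 1 :> R.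
    by rewrite sumr_const_nat subn1 -natr1 addrK.
  rewrite (@big_nat_widen _ _ _ _ m.+1 n.+1) 1?ltnW // big_mkcond [leRHS]big_mkcond.
  apply: ler_sum => b _; case: ifP => [bm|_]; last by case: ifP.
  by rewrite Plo // (lt_le_trans _ my) // ltr_nat.
rewrite -natr1 in ym; rewrite ler_norml; apply/andP; split; lra.
Qed.

Lemma count_fractions_in_itv (R : realType) (bl br : bool) (l r : R) (n : nat) :
  0 <= l -> l < r -> r <= 1 -> (0 < n)%N ->
  `|\sum_(1 <= b < n.+1 |
       (b%:R / n%:R : R) \in Interval (BSide bl l) (BSide br r)) 1 - (r - l) * n%:R|
  <= 4.
Proof.
move=> l0 lr r1 n0; have nR : 0 < n%:R :> R by rewrite ltr0n.
(* [Pl]: b / n lies to the left of the interval; [Pr]: it does not lie to the right. The flag [true]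
   closes a left end but opens a right one. The count wanted is that of [Pr] minus that of [Pl],
   each known up to 2. *)
pose Pl b := ~~ (l < b%:R / n%:R ?<= if bl); pose Pr b := b%:R / n%:R < r ?<= if ~~ br.
have hl : `|\sum_(1 <= b < n.+1 | Pl b) 1 - l * n%:R| <= 2.
  apply: count_initial_segment => [|b|b]; rewrite ?/Pl.
  - by rewrite mulr_ge0 ?ler0n //= ler_piMl //; lra.
  - rewrite -ltr_pdivrMr // => h; apply/negP => /lteifW; lra.
  - rewrite -lteifNE ?num_real // => /lteifW; by rewrite ler_pdivrMr.
have hr : `|\sum_(1 <= b < n.+1 | Pr b) 1 - r * n%:R| <= 2.
  apply: count_initial_segment => [|b|b]; rewrite ?/Pr.
  - by rewrite mulr_ge0 ?ler0n //= ?ler_piMl //; lra.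
  - by rewrite -ltr_pdivrMr // => h; apply: lteifS.
  - by move/lteifW; rewrite ler_pdivrMr.
have E : \sum_(1 <= b < n.+1 | Pr b) 1 = \sum_(1 <= b < n.+1 | Pl b) 1 +
   \sum_(1 <= b < n.+1 | (b%:R / n%:R : R) \in Interval (BSide bl l) (BSide br r)) 1 :> R.
  rewrite (bigID Pl) /=; congr (_ + _); apply: eq_bigl => b.
    rewrite andbC; case: (boolP (Pl b)) => //=.
    rewrite /Pl -lteifNE ?num_real // => /lteifW h; apply: lteifS; lra.
  by rewrite itv_boundlr /= /Pl /Pr negbK andbC.
move: E hl hr; set a := \sum_(1 <= b < n.+1 | Pl b) 1.
set c := \sum_(1 <= b < n.+1 | Pr b) 1.
set d := bigop _ _ _ => E; rewrite !ler_norml => /andP[h1 h2] /andP[h3 h4].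
by apply/andP; split; lra.
Qed.

(** [fine] sends an infinite measure to 0, so positive length forces finite ends. An end outside
    [0, 1] would put a point outside [0, 1] into the interval: a midpoint, which belongs to it
    whichever ends are closed. *)
Lemma itv_length_gt0P (R : realType) (I : interval R) :
  {subset I <= `[0, 1]} -> 0 < itv_length I ->
  exists bl l br r, [/\ I = Interval (BSide bl l) (BSide br r),
    itv_length I = r - l, 0 <= l, l < r & r <= 1].
Proof.
case: I => [[bl l|[]] [br r|[]]] sub; rewrite /itv_length lebesgue_measure_itv /=
  ?lte_fin ?ltxx //; case: ifP => //= lr; rewrite ?ltxx // => _.
exists bl, l, br, r; split => //.
- rewrite leNgt; apply/negP => l0.
  have := sub ((l + Order.min r 0) / 2).
  have : l < Order.min r 0 by rewrite lt_min lr.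
  have : Order.min r 0 <= r by rewrite ge_min lexx.
  have : Order.min r 0 <= 0 by rewrite ge_min lexx orbT.
  move: (Order.min r 0) => m m0 mr lm.
  rewrite !in_itv /= => h; suff : 0 <= (l + m) / 2 <= 1 by lra.
  by apply: h; apply/andP; split; apply: lteifS; lra.
- rewrite leNgt; apply/negP => r1.
  have := sub ((r + Order.max l 1) / 2).
  have : Order.max l 1 < r by rewrite gt_max lr.
  have : l <= Order.max l 1 by rewrite le_max lexx.
  have : 1 <= Order.max l 1 by rewrite le_max lexx orbT.
  move: (Order.max l 1) => m m0 mr lm.
  rewrite !in_itv /= => h; suff : 0 <= (r + m) / 2 <= 1 by lra.
  by apply: h; apply/andP; split; apply: lteifS; lra.
Qed.

Definition harmonic_sum (R : realType) (N : nat) : R := \sum_(1 <= k < N.+1) k%:R^-1.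

Lemma harmonic_sum_ge1 (R : realType) (N : nat) : (0 < N)%N -> 1 <= harmonic_sum R N.
Proof.
by move=> N0; rewrite /harmonic_sum big_nat_recl // invr1 lerDl sumr_ge0.
Qed.

(** Induction by ln (1 + x) <= x at x = - 1 / (k + 1). *)
Lemma harmonic_sum_le_ln (R : realType) (N : nat) : (0 < N)%N ->
  harmonic_sum R N <= 1 + ln N%:R.
Proof.
rewrite /harmonic_sum; case: N => // N _; elim: N => [|N IH].
  by rewrite big_nat1 invr1 ln1 addr0.
rewrite big_nat_recr //=; set k := N.+1 in IH *.
have k0 : 0 < k%:R :> R by rewrite ltr0n.
have k1 : 0 < k.+1%:R :> R by rewrite ltr0n.
suff : ln (k%:R / k.+1%:R) <= - k.+1%:R^-1 :> R.
  rewrite ln_div ?posrE //; move: IH.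
  move: (\sum_(1 <= i < k.+1) _) (ln k.+1%:R) (ln k%:R) (k.+1%:R^-1) => a b c d.
  by lra.
have -> : k%:R / k.+1%:R = 1 + - k.+1%:R^-1 :> R.
  by rewrite -natr1 in k1 *; field; rewrite gt_eqF.
apply: le_ln1Dx; rewrite ltrN2 invf_lt1 // ltr1n //.
Qed.

(** For t = eps^(- delta / 2) >= 1, the inequality ln t < t reads - ln eps < (2 / delta) t. *)
Lemma harmonic_sum_le_powR (R : realType) (delta eps : R) :
  0 < delta -> 0 < eps -> eps <= 1 / 2 ->
  harmonic_sum R (Num.truncn (1 / eps)) <= (1 + 2 / delta) * eps `^ (- (delta / 2)).
Proof.
move=> d0 e0 e1; set N := Num.truncn _.
have ie : 2 <= 1 / eps by rewrite ler_pdivlMr //; lra.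
have /andP[Ne _] : N%:R <= 1 / eps < N.+1%:R by apply: truncn_itv; lra.
have N0 : (0 < N)%N by rewrite truncn_gt0; lra.
apply: le_trans (harmonic_sum_le_ln R N0) _.
have lnN : ln N%:R <= - ln eps :> R.
  by rewrite -lnV ?posrE // ler_ln ?posrE ?ltr0n ?invr_gt0 // -div1r.
have t1 : 1 <= eps `^ (- (delta / 2)).
  rewrite -[leLHS](powRr0 eps); apply: ger_powR; first by rewrite e0; lra.
  by rewrite oppr_le0 divr_ge0 // ltW.
have := ln_sublinear (lt_le_trans ltr01 t1); rewrite ln_powR.
move: t1; set t := _ `^ _ => t1 h.
have : 2 / delta * (- (delta / 2) * ln eps) <= 2 / delta * t.
  by rewrite ler_wpM2l ?ltW // divr_gt0.
have -> : 2 / delta * (- (delta / 2) * ln eps) = - ln eps by field; rewrite gt_eqF.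
lra.
Qed.

(** * Weighted sums over denominators *)

(* Meant for q > 0; the square root of a negative number is 0, which makes the
   weight vanish past 1 / s. *)
Definition chord_weight (R : realType) (s : R) (q : nat) : R :=
  Num.sqrt (1 - (q%:R * s) ^+ 2) / q%:R.

Lemma chord_weight_ge0 (R : realType) (s : R) (q : nat) : 0 <= chord_weight s q.
Proof. by rewrite divr_ge0 // sqrtr_ge0. Qed.

Lemma chord_weight_le (R : realType) (s : R) (q : nat) : chord_weight s q <= q%:R^-1.
Proof.
rewrite /chord_weight ler_piMl ?invr_ge0 // -[leRHS]sqrtr1 ler_sqrt //.
by rewrite lerBlDr lerDl sqr_ge0.
Qed.

Lemma chord_weight_eq0 (R : realType) (s : R) (q : nat) :
  1 <= q%:R * s -> chord_weight s q = 0.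
Proof.
by move=> qs; rewrite /chord_weight ler0_sqrtr ?mul0r // subr_le0 exprn_ege1.
Qed.

(** With 2 r = 1 / q^2, r^2 - (eps - r)^2 = eps (2 r - eps) = eps (1 - q^2 eps) / q^2. *)
Lemma ford_chordE (R : realType) (eps : R) (q : nat) : 0 < eps -> (0 < q)%N ->
  ford_chord eps q = 2 * Num.sqrt eps * chord_weight (Num.sqrt eps) q.
Proof.
move=> e0 q0; have qR : 0 < q%:R :> R by rewrite ltr0n.
rewrite /ford_chord /chord_weight /ford_radius -mulrA; congr (2 * _).
have sE : (q%:R * Num.sqrt eps) ^+ 2 = q%:R ^+ 2 * eps.
  by rewrite exprMn sqr_sqrtr // ltW.
rewrite sE.
have -> : (1 / (2 * q%:R ^+ 2)) ^+ 2 - (eps - 1 / (2 * q%:R ^+ 2)) ^+ 2 =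
    eps * (q%:R^-1 ^+ 2 * (1 - q%:R ^+ 2 * eps)).
  by field; rewrite gt_eqF.
rewrite sqrtrM ?(ltW e0) // sqrtrM ?sqr_ge0 // sqrtr_sqr ger0_norm ?invr_ge0 //.
by rewrite [_^-1 * _]mulrC.
Qed.

(** V(n) of the overview, cut off at N; when 1 <= s (N + 1) and n > 0, the weights beyond the
    cut-off vanish. *)
Definition weighted_sum (R : realType) (s : R) (N : nat) (c : nat -> R) (n : nat) : R :=
  \sum_(1 <= q < N.+1) c q * chord_weight s (q * n)%N.

Lemma chord_weight_vanish (R : realType) (s : R) (N n : nat) :
  0 < s -> 1 <= s * N.+1%:R -> (N < n)%N -> chord_weight s n = 0.
Proof.
move=> s0 sN Nn; apply: chord_weight_eq0; apply: (le_trans sN); rewrite mulrC.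
by apply: ler_wpM2r; [exact: ltW|rewrite ler_nat].
Qed.

Lemma sum_weighted_sum_multiples (R : realType) (s : R) (N : nat)
    (c : nat -> R) (j : nat) :
  0 < s -> 1 <= s * N.+1%:R -> (0 < j)%N ->
  \sum_(1 <= k < N.+1) weighted_sum s N c (j * k)%N =
  \sum_(1 <= n < N.+1) (\sum_(1 <= q < n.+1 | (q %| n)%N) c q) *
    chord_weight s (n * j)%N.
Proof.
move=> s0 sN j0; rewrite exchange_big /=.
rewrite (big_nat_divisors (F := fun q k => c q * chord_weight s (q * (j * k))%N)); last first.
  by move=> q k Nqk; rewrite (chord_weight_vanish s0 sN) ?mulr0 //; nia.
apply: eq_big_nat => n /andP[n0 nN].
rewrite (@big_divisors_widen _ n N) ?n0 // big_distrl; apply: eq_bigr => q qn /=.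
by congr (_ * chord_weight s _); rewrite mulnCA [(q * _)%N]mulnC divnK // mulnC.
Qed.

(** Replacing the divisor sums by L n costs at most 4 / (n j) for each n, in all 4 H / j. What
    remains is L / j times a Riemann sum for the quarter disk, with error at most 1 <= H. *)
Lemma sum_weighted_sum_multiples_estimate (R : realType) (s L : R) (N : nat)
    (c : nat -> R) (j : nat) :
  (0 < N)%N -> 0 < s -> 1 <= s * N.+1%:R -> 0 <= L <= 1 ->
  (forall n, (0 < n)%N ->
    `|\sum_(1 <= q < n.+1 | (q %| n)%N) c q - L * n%:R| <= 4) ->
  (0 < j)%N ->
  `|\sum_(1 <= k < N.+1) weighted_sum s N c (j * k)%N - L * pi / (4 * s) / j%:R ^+ 2| <=
  5 * harmonic_sum R N / j%:R.
Proof.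
move=> N0 s0 sN /andP[L0 L1] c_divisors j0.
rewrite sum_weighted_sum_multiples //; set H := harmonic_sum R N.
have jR : 0 < j%:R :> R by rewrite ltr0n.
have H1 : 1 <= H by exact: harmonic_sum_ge1.
(* The point n = Y is where the weight of n j vanishes; L / j times Y pi / 4 is the main term. *)
pose Y := (j%:R * s)^-1; have Y0 : 0 < Y by rewrite invr_gt0 mulr_gt0.
have YN : Y <= N.+1%:R.
  rewrite /Y invf_ple ?posrE ?mulr_gt0 // ?ltr0n //.
  rewrite -[leLHS]mul1r ler_pdivrMr ?ltr0n //.
  apply: (le_trans sN); rewrite -mulrA ler_peMl ?ler1n //.
  by apply: le_trans sN.
have /andP[h1 h2] := sum_sqrt_riemann Y0 YN.
set G := \sum_(1 <= n < N.+1) Num.sqrt _ in h1 h2.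
have GE : L / j%:R * G = \sum_(1 <= n < N.+1) L * n%:R * chord_weight s (n * j)%N.
  rewrite mulr_sumr; apply: eq_big_nat => n /andP[n0 _].
  have nR : 0 < n%:R :> R by rewrite ltr0n.
  rewrite /chord_weight /Y invrK natrM mulrA; set g := Num.sqrt _.
  by field; rewrite !gt_eqF.
set S := \sum_(1 <= n < N.+1) _.
have SG : `|S - L / j%:R * G| <= 4 * H / j%:R.
  rewrite GE -sumrB; apply: le_trans (ler_norm_sum _ _ _) _.
  rewrite /H /harmonic_sum mulrAC mulr_sumr !big_nat; apply: ler_sum => n /andP[n0 _].
  rewrite -mulrBl normrM -mulrA ler_pM // ?c_divisors //.
  rewrite ger0_norm ?chord_weight_ge0 // (le_trans (chord_weight_le _ _)) //.
  by rewrite natrM invfM mulrC.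
have GY : `|L / j%:R * G - L * pi / (4 * s) / j%:R ^+ 2| <= H / j%:R.
  have -> : L * pi / (4 * s) / j%:R ^+ 2 = L / j%:R * (Y * (pi / 4)).
    by rewrite /Y; move: (@pi R) => p; field; rewrite !gt_eqF.
  have Lj : 0 <= L / j%:R by rewrite divr_ge0 // ltW.
  rewrite -mulrBr normrM (ger0_norm Lj).
  rewrite mulrAC; apply: ler_wpM2r; first by rewrite invr_ge0 ltW.
  apply: le_trans (_ : 1 * 1 <= _); last by rewrite mulr1.
  by apply: ler_pM => //; rewrite ler_norml; apply/andP; split; lra.
have -> : S - L * pi / (4 * s) / j%:R ^+ 2 =
  (S - L / j%:R * G) + (L / j%:R * G - L * pi / (4 * s) / j%:R ^+ 2) by ring.
apply: le_trans (ler_normD _ _) _.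
have -> : 5 * H / j%:R = 4 * H / j%:R + H / j%:R by ring.
exact: lerD.
Qed.

(** A = 3 L / (2 pi s) satisfies A pi^2 / 6 = L pi / (4 s), so only the truncation error of zeta(2)
    at m = N / j is left, at most 5 A / (j^2 m); A <= 3 j m makes this 15 / j. *)
Lemma main_term_estimate (R : realType) (s L : R) (N j : nat) :
  0 < s -> 1 <= s * N.+1%:R -> 0 <= L <= 1 -> (0 < j <= N)%N ->
  `|3 * L / (2 * pi * s) / j%:R ^+ 2 * zeta2_sum R (N %/ j) -
    L * pi / (4 * s) / j%:R ^+ 2| <=
  15 / j%:R.
Proof.
move=> s0 sN /andP[L0 L1] /andP[j0 jN]; set A := 3 * L / (2 * pi * s).
have jR : 0 < j%:R :> R by rewrite ltr0n.
have pi0 := pi_gt0 R; have pi2 := pi_ge2 R; set m := (N %/ j)%N.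
have m0 : (0 < m)%N by rewrite divn_gt0.
have mR : 0 < m%:R :> R by rewrite ltr0n.
have -> : A / j%:R ^+ 2 * zeta2_sum R m - L * pi / (4 * s) / j%:R ^+ 2 =
    A / j%:R ^+ 2 * (zeta2_sum R m - pi ^+ 2 / 6).
  rewrite /A; move: (zeta2_sum R m) (@pi R) pi0 => z p p0; field.
  by rewrite !gt_eqF.
have A0 : 0 <= A.
  by apply: divr_ge0; [exact: mulr_ge0|apply: ltW; rewrite !mulr_gt0].
have Aj : 0 <= A / j%:R ^+ 2 by rewrite divr_ge0 // exprn_ge0 // ltW.
rewrite normrM (ger0_norm Aj).
apply: le_trans (ler_wpM2l Aj (zeta2_sum_estimate R m0)) _.
have mj : N%:R <= 2 * j%:R * m%:R :> R.
  rewrite -!natrM ler_nat; have := ltn_ceil N j0; rewrite -/m => hN.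
  have : (m.+1 <= 2 * m)%N by lia.
  nia.
have sN2 : 1 <= 2 * s * N%:R.
  apply: (le_trans sN); rewrite mulrAC mulrC.
  by apply: ler_wpM2r; [exact: ltW|rewrite -natrM ler_nat; lia].
(* From N <= 2 j m and 1 <= 2 s N follows 1 <= 4 s j m; L <= 1 and pi >= 2 do the rest. *)
have key : A <= 3 * (j%:R * m%:R).
  rewrite /A ler_pdivrMr ?mulr_gt0 //.
  apply: (@le_trans _ _ 3); first by lra.
  have : 1 <= 4 * s * (j%:R * m%:R).
    apply: (le_trans sN2); have := ler_wpM2l (ltW s0) mj; lra.
  move=> h4; have t0 : 0 <= 4 * s * (j%:R * m%:R) by lra.
  have := ler_wpM2r t0 pi2; lra.
rewrite -subr_ge0.
have -> : 15 / j%:R - A / j%:R ^+ 2 * (5 / m%:R) =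
  5 * (3 * (j%:R * m%:R) - A) / (j%:R ^+ 2 * m%:R).
  by field; rewrite !gt_eqF.
by rewrite divr_ge0 ?mulr_ge0 ?exprn_ge0 // subr_ge0.
Qed.

(** Moebius inversion of V(n) - A / n^2: as the Moebius function is at most 1 in size, each j costs
    at most (5 H + 15) / j <= 20 H / j, and summing 1 / j gives another H. *)
Lemma weighted_sum_estimate (R : realType) (s L : R) (N : nat) (c : nat -> R) :
  (0 < N)%N -> 0 < s -> 1 <= s * N.+1%:R -> 0 <= L <= 1 ->
  (forall n, (0 < n)%N ->
    `|\sum_(1 <= q < n.+1 | (q %| n)%N) c q - L * n%:R| <= 4) ->
  `|weighted_sum s N c 1 - 3 * L / (2 * pi * s)| <= 20 * harmonic_sum R N ^+ 2.
Proof.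
move=> N0 s0 sN L01 c_divisors; set H := harmonic_sum R N; set A := 3 * L / _.
have H1 : 1 <= H by exact: harmonic_sum_ge1.
(* The cut-off at N makes the Moebius inversion a finite sum. *)
pose u (n : nat) := if (n <= N)%N then weighted_sum s N c n - A / n%:R ^+ 2 else 0.
have -> : weighted_sum s N c 1 - A = u 1%N by rewrite /u N0 expr1n divr1.
rewrite (mobius_inversion_at1 (u := u) N0) => [|n Nn]; last by rewrite /u leqNgt Nn.
apply: le_trans (ler_norm_sum _ _ _) _.
have -> : 20 * H ^+ 2 = \sum_(1 <= j < N.+1) 20 * H / j%:R.
  by rewrite -mulr_sumr expr2 mulrA.
rewrite !big_nat; apply: ler_sum => j /andP[j0 jN].
rewrite normrM -[leRHS]mul1r ler_pM ?norm_mobius_le1 //.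
have jR : 0 < j%:R :> R by rewrite ltr0n.
(* V(j k) is already 0 once j k > N, so the cut-off shortens only the sum of A / (j k)^2, to k <= N
   / j. *)
have -> : \sum_(1 <= k < N.+1) u (j * k)%N =
    \sum_(1 <= k < N.+1) weighted_sum s N c (j * k)%N -
    A / j%:R ^+ 2 * zeta2_sum R (N %/ j).
  rewrite /zeta2_sum mulr_sumr (@big_nat_widen _ _ _ _ (N %/ j).+1 N.+1); last first.
    by rewrite ltnS leq_div.
  rewrite [X in _ - X]big_mkcond -sumrB; apply: eq_big_nat => k /andP[k0 _] /=.
  rewrite /u ltnS leq_divRL // [(k * j)%N]mulnC; case: ifP => [jk|/negbT jk].
    by rewrite natrM exprMn invfM mulrA.
  rewrite subr0 /weighted_sum big_nat big1 // => q /andP[q0 _].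
  by rewrite (chord_weight_vanish s0 sN) ?mulr0 //; nia.
have e1 := sum_weighted_sum_multiples_estimate N0 s0 sN L01 c_divisors j0.
have e2 : `|A / j%:R ^+ 2 * zeta2_sum R (N %/ j) -
    L * pi / (4 * s) / j%:R ^+ 2| <= 15 / j%:R.
  by apply: main_term_estimate; rewrite ?j0.
move: e1 e2; rewrite -/H; set a := \sum_(1 <= k < N.+1) _.
set b := _ * zeta2_sum R _; set z := L * pi / (4 * s) / j%:R ^+ 2 => e1 e2.
have -> : a - b = (a - z) - (b - z) by ring.
apply: le_trans (ler_normB _ _) _.
apply: le_trans (lerD e1 e2) _.
by rewrite -mulrDl; apply: ler_wpM2r; [rewrite invr_ge0 ltW|lra].
Qed.

Theorem theorem6 (R : realType) (delta : R) (hdelta : 0 < delta) :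
  exists C : R, forall (I : interval R) (eps : R),
    {subset I <= `[0, 1]} -> 0 < itv_length I ->
    0 < eps -> eps <= 1 / 2 ->
    `|ford_prob I eps - 3 / pi| <=
      C * ((itv_length I)^-1 * eps `^ (1 / 2 - delta)).
Proof.
(* 40 = 2 * 20, the 2 coming from the chord length 2 s w(q); the square comes from H^2. *)
exists (40 * (1 + 2 / delta) ^+ 2) => I eps subI I0 e0 e1.
rewrite /ford_prob; set N := Num.truncn (1 / eps); set L := itv_length I.
set s := Num.sqrt eps; have s0 : 0 < s by rewrite sqrtr_gt0.
have s2 : s ^+ 2 = eps by rewrite sqr_sqrtr // ltW.
have pi0 := pi_gt0 R.
have ie : 2 <= 1 / eps by rewrite ler_pdivlMr //; lra.
have /andP[_ Ne] : N%:R <= 1 / eps < N.+1%:R by apply: truncn_itv; lra.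
have N0 : (0 < N)%N by rewrite truncn_gt0; lra.
have sN : 1 <= s * N.+1%:R.
  have s1 : s <= 1 by rewrite -sqrtr1 ler_sqrt //; lra.
  have : 1 <= s ^+ 2 * N.+1%:R by rewrite s2 mulrC -ler_pdivrMr // ltW.
  move/le_trans; apply; apply: ler_wpM2r => //.
  by rewrite expr2 ler_piMl // ltW.
pose c (q : nat) : R :=
  \sum_(1 <= a < q.+1 | coprime a q && ((a%:R / q%:R : R) \in I)) 1.
(* Denominators with q^2 > 1 / eps, filtered out on the left, have weight 0 on the right. *)
have -> : \sum_(1 <= q < N.+1 | (q%:R ^+ 2 <= 1 / eps :> R))
    \sum_(1 <= a < q.+1 | coprime a q && ((a%:R / q%:R : R) \in I)) ford_chord eps q =
    2 * s * weighted_sum s N c 1.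
  rewrite /weighted_sum mulr_sumr big_mkcond; apply: eq_big_nat => q /andP[q0 _].
  rewrite muln1 /c mulrCA big_distrl /=; case: ifP => [_|/negbT].
    by apply: eq_bigr => a _; rewrite mul1r ford_chordE.
  rewrite -ltNge ltr_pdivrMr // => qe.
  have qs : 1 <= q%:R * s.
    by rewrite -(@ler_sqr R) ?nnegrE ?mulr_ge0 ?(ltW s0) // expr1n exprMn s2 ltW.
  by rewrite big1 // => a _; rewrite chord_weight_eq0 // !mulr0.
have [bl [l [br [r [IE LE l0 lr r1]]]]] := itv_length_gt0P subI I0.
(* Over all q dividing n, the reduced a / q in I are exactly the b / n in I with 1 <= b <= n. *)
have cL n : (0 < n)%N -> `|\sum_(1 <= q < n.+1 | (q %| n)%N) c q - L * n%:R| <= 4.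
  move=> n0; rewrite /L LE.
  have := count_fractions_in_itv bl br l0 lr r1 n0; rewrite -IE; congr (`|_ - _| <= _).
  rewrite big_mkcond.
  rewrite -(big_gcd_partition (fun b => if (b%:R / n%:R : R) \in I then 1 else 0) n0).
  rewrite big_nat_cond [RHS]big_nat_cond.
  apply: eq_bigr => q /andP[/andP[q0 _] qn]; rewrite /c big_mkcondr.
  apply: eq_bigr => a _; congr (if _ \in I then _ else _).
  case/dvdnP: qn n0 => m -> n0; rewrite mulnK // !natrM.
  by field; rewrite !pnatr_eq0; lia.
have L01 : 0 <= L <= 1 by rewrite /L LE; apply/andP; split; lra.
have L0 : 0 < L by [].
have main := weighted_sum_estimate N0 s0 sN L01 cL.
have -> : L^-1 * (2 * s * weighted_sum s N c 1) - 3 / pi =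
    L^-1 * (2 * s * (weighted_sum s N c 1 - 3 * L / (2 * pi * s))).
  move: (weighted_sum _ _ _ _) (@pi R) pi0 => z p p0; field.
  by rewrite (gt_eqF p0) (gt_eqF s0) (gt_eqF L0).
have Li : 0 <= L^-1 by rewrite invr_ge0 ltW.
rewrite normrM (ger0_norm Li) [leRHS]mulrCA; apply: ler_wpM2l => //.
have ss : 0 <= 2 * s by lra.
rewrite normrM (ger0_norm ss); apply: le_trans (ler_wpM2l ss main) _.
have H1 := harmonic_sum_ge1 R N0.
have := harmonic_sum_le_powR hdelta e0 e1; rewrite -/N; set t := _ `^ _ => Ht.
have -> : eps `^ (1 / 2 - delta) = s * t ^+ 2.
  rewrite /s -powR12_sqrt ?(ltW e0) // /t -powR_mulrn ?powR_ge0 // -powRrM -powRD.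
    by congr (_ `^ _); field.
  by rewrite (gt_eqF e0) implybT.
have : harmonic_sum R N ^+ 2 <= ((1 + 2 / delta) * t) ^+ 2.
  by rewrite ler_sqr ?nnegrE ?(le_trans _ Ht) //; lra.
move/(ler_wpM2l (mulr_ge0 (ler0n R 20) ss)).
rewrite exprMn; move: ((1 + 2 / delta) ^+ 2) (t ^+ 2) (harmonic_sum _ _ ^+ 2) => x y z.
by move=> h; apply: le_trans (_ : 20 * (2 * s) * (x * y) <= _); [apply: le_trans h|]; lra.
Qed.
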